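(* Let $1<p\le2$, $q=p/(p-1)$, $n\ge2$, $0<\epsilon<1$, $0<\delta<1$. Let $A$ be any distribution on $\{1,\dots,n\}$, draw $m=\left(\frac3\delta\right)^{\frac1{p-1}}\frac1{\epsilon^q}$ i.i.d. samples from $A$, let $X_i$ be the number of samples equal to $i$, and let $\hat A_i=X_i/m$. Then $\Pr[\|\hat A-A\|_p\le\epsilon]\ge1-\delta$.
   Context: A distribution on $\{1,\dots,n\}$ is a vector $A\in\mathbb{R}^n$ with $A_i\ge0$, $\sum_iA_i=1$; $\|V\|_p=(\sum_i|V_i|^p)^{1/p}$. *)

(* Defs.v *)
From mathcomp Require Import all_boot all_order all_algebra.
From mathcomp Require Import all_classical all_reals all_analysis.

Set Implicit Arguments.
Unset Strict Implicit.
Unset Printing Implicit Defensive.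

Import Order.TTheory GRing.Theory Num.Theory.
Import numFieldNormedType.Exports.

Local Open Scope classical_set_scope.
Local Open Scope ring_scope.

(* The support {1, ..., n} is represented by 'I_n = {0, ..., n-1}. *)
Definition is_distribution (R : realType) (n : nat) (A : 'rV[R]_n) : Prop :=
  (forall i, 0 <= A 0 i) /\ \sum_(i < n) A 0 i = 1.

Definition pnorm (R : realType) (n : nat) (p : R) (V : 'rV[R]_n) : R :=
  (\sum_(i < n) `|V 0 i| `^ p) `^ p^-1.

(* 'I_n carries no measurable structure in the library; it is given the
   discrete sigma-algebra here, so the conditions range over all B : set 'I_n. *)
Record iid_samples (R : realType) (d : measure_display) (T : measurableType d)
    (P : probability T R) (n m : nat) (A : 'rV[R]_n)
    (S : 'I_m -> T -> 'I_n) : Prop := IidSamples {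
  sample_measurable : forall (k : 'I_m) (B : set 'I_n),
    measurable (S k @^-1` B) ;
  sample_law : forall (k : 'I_m) (i : 'I_n),
    P (S k @^-1` [set i]) = (A 0 i)%:E ;
  sample_indep : forall (J : {set 'I_m}) (B : 'I_m -> set 'I_n),
    P (\bigcap_(k in [set` J]) (S k @^-1` B k)) =
    (\prod_(k in J) P (S k @^-1` B k))%E }.

Definition sample_count (T : Type) (n m : nat) (S : 'I_m -> T -> 'I_n)
    (i : 'I_n) (w : T) : nat :=
  #|[set k : 'I_m | S k w == i]%SET|.

Definition empirical (R : realType) (T : Type) (n m : nat)
    (S : 'I_m -> T -> 'I_n) (w : T) : 'rV[R]_n :=
  \row_(i < n) ((sample_count S i w)%:R / m%:R).

(* Main.v *)
(* Only second moments are needed. If N is a natural number, 0 <= mu and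
   1 <= p <= 2, then |N - mu|^p <= mu + (N - mu)^2: the integrality of N takes
   care of deviations smaller than 1. Applied to the counts X_i, whose mean is
   mu_i = m A_i and whose variance is at most mu_i, this gives
   E[sum_i |X_i - mu_i|^p] <= 2 m, and Markov's inequality concludes, the choice
   of m being such that 3 m <= delta (m eps)^p. *)
Require Import Defs.
From mathcomp Require Import all_boot all_order all_algebra.
From mathcomp Require Import all_classical all_reals all_analysis.
From mathcomp Require Import measurable_realfun ring lra.

Set Implicit Arguments.
Unset Strict Implicit.

Import Order.TTheory GRing.Theory Num.Theory.
Import numFieldNormedType.Exports.

Local Open Scope classical_set_scope.
Local Open Scope ring_scope.

(** * Pointwise bound on powers of deviations from an integer *)

Lemma powR_le_sqr (R : realType) (p t : R) :
  p <= 2 -> 1 <= t -> t `^ p <= t ^+ 2.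
Proof.
move=> p2 t1; rewrite -powR_mulrn ?ler_powR//.
exact: le_trans t1.
Qed.

Lemma powR_le_id (R : realType) (p t : R) :
  1 <= p -> 0 <= t <= 1 -> t `^ p <= t.
Proof.
move=> p1 /andP[]; rewrite le_eqVlt => /predU1P[<- _|t0 t1].
  by rewrite powR0// gt_eqF// (lt_le_trans _ p1).
by rewrite ge1r_powR// t0.
Qed.

Lemma powR_dist_natr_le (R : realType) (p mu : R) (N : nat) :
  1 <= p <= 2 -> 0 <= mu ->
  `|N%:R - mu| `^ p <= mu + (N%:R - mu) ^+ 2.
Proof.
move=> /andP[p1 p2] mu0; have [d1|d1] := leP 1 `|N%:R - mu|.
  rewrite (le_trans (powR_le_sqr p2 d1))// real_normK ?num_real//.
  by rewrite lerDr.
apply: (@le_trans _ _ `|N%:R - mu|); first by rewrite powR_le_id// normr_ge0 ltW.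
move: d1; case: N => [|N].
  by rewrite sub0r normrN ger0_norm// => _; rewrite lerDl sqr_ge0.
have : 1 <= N.+1%:R :> R by rewrite ler1n.
move: (N.+1%:R : R) => x x1.
(* If [x <= mu], the claim follows from [mu - x <= mu]. Otherwise put [t = x - mu]: since
   [mu >= 1 - t], one gets [mu + t ^+ 2 - t >= (1 - t) ^+ 2 >= 0]. *)
have := sqr_ge0 (x - mu); have := sqr_ge0 (1 - (x - mu)).
by rewrite !expr2; case: (ler0P (x - mu)) => _ *; lra.
Qed.

(** * Second moments of a sum of pairwise independent, equiprobable events *)

Section sum_of_events.
Context (R : realType) (d : measure_display) (T : measurableType d).
Variables (P : probability T R) (m : nat) (E : 'I_m -> set T) (a : R).
Hypothesis a0 : 0 <= a.
Hypothesis mE : forall k, measurable (E k).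
Hypothesis PE : forall k, P (E k) = a%:E.
Hypothesis PEE : forall k l, k != l -> P (E k `&` E l) = (a * a)%:E.

Let X (w : T) : R := \sum_(k < m) \1_(E k) w.

Let mX : measurable_fun setT X.
Proof. by apply: measurable_sum => k; exact: measurable_indic. Qed.

Let X0 w : 0 <= X w.
Proof. by apply: sumr_ge0 => k _; rewrite indicE. Qed.

Lemma integral_sum_events : (\int[P]_w (X w)%:E = (m%:R * a)%:E)%E.
Proof.
under eq_integral do rewrite /X -sumEFin.
rewrite ge0_integral_sum//; last first.
  by move=> k; apply/measurable_EFinP; exact: measurable_indic.
transitivity (\sum_(k < m) a%:E)%E.
  by apply: eq_bigr => k _; rewrite integral_indic// setIT; exact: PE.
by rewrite sumEFin sumr_const card_ord mulr_natl.
Qed.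

(** The square expands into a double sum of probabilities of pairwise intersections, equal to [a] on
    the diagonal and to [a * a] off it. *)
Lemma integral_sum_events_sqr_le :
  (\int[P]_w (X w ^+ 2)%:E <= (m%:R * a + (m%:R * a) ^+ 2)%:E)%E.
Proof.
have mI k l : measurable (E k `&` E l) by exact: measurableI.
have -> : (\int[P]_w (X w ^+ 2)%:E =
    \sum_(k < m) \sum_(l < m) P (E k `&` E l))%E.
  transitivity (\int[P]_w
      (\sum_(k < m) \sum_(l < m) (\1_(E k `&` E l) w)%:E))%E.
    apply: eq_integral => w _; rewrite expr2 /X mulr_suml -sumEFin.
    apply: eq_bigr => k _; rewrite mulr_sumr -sumEFin.
    by apply: eq_bigr => l _; rewrite indicI.
  rewrite ge0_integral_sum//; last 2 first.
  - move=> k; apply: emeasurable_sum => l.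
    by apply/measurable_EFinP; exact: measurable_indic.
  - by move=> k w _; apply: sume_ge0 => l _; rewrite lee_fin indicE.
  apply: eq_bigr => k _; rewrite ge0_integral_sum//; last first.
    by move=> l; apply/measurable_EFinP; exact: measurable_indic.
  by apply: eq_bigr => l _; rewrite integral_indic// setIT.
(* Enlarging the diagonal terms from [a] to [a + a * a] lets [a * a] be summed over all [m ^ 2]
   pairs, which yields exactly [(m%:R * a) ^+ 2]. *)
apply: (@le_trans _ _
    (\sum_(k < m) \sum_(l < m) ((k == l)%:R * a + a * a)%:E)%E).
  apply: lee_sum => k _; apply: lee_sum => l _.
  have [<-|/PEE ->] := eqVneq k l; last by rewrite mul0r add0r.
  by rewrite setIid PE lee_fin mul1r lerDl mulr_ge0.
under eq_bigr do rewrite sumEFin.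
rewrite sumEFin lee_fin.
under eq_bigr => k _.
  rewrite big_split/= sumr_const card_ord (bigD1 k)//= eqxx mul1r.
  rewrite big1 ?addr0; last by move=> l /negPf; rewrite eq_sym => ->; rewrite mul0r.
  over.
rewrite sumr_const card_ord -[X in X <= _]mulr_natl -[(a * a) *+ m]mulr_natl.
by rewrite le_eqVlt; apply/orP; left; apply/eqP; ring.
Qed.

(** With [c = m%:R * a] the mean of [X], the variance is the second moment minus [c ^+ 2], and the
    second moment is at most [c + c ^+ 2]. *)
Lemma variance_sum_events_le :
  (\int[P]_w ((X w - m%:R * a) ^+ 2)%:E <= (m%:R * a)%:E)%E.
Proof.
have c0 : 0 <= m%:R * a by rewrite mulr_ge0.
move: (m%:R * a) c0 integral_sum_events integral_sum_events_sqr_le => c c0 IX IX2.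
have mXc : measurable_fun setT (fun w => (X w - c) ^+ 2).
  by apply: measurable_funX; exact: measurable_funB.
have mX2 : measurable_fun setT (fun w => X w ^+ 2) by exact: measurable_funX.
(* Integrating (X - c)^2 + 2 c X = X^2 + c^2 keeps every integrand
   nonnegative, so no integrability side condition arises. *)
have : (\int[P]_w ((X w - c) ^+ 2)%:E + (2 * c)%:E * \int[P]_w (X w)%:E =
        \int[P]_w (X w ^+ 2)%:E + (c ^+ 2)%:E)%E.
  rewrite -ge0_integralZl_EFin//; last 3 first.
  - by move=> w _; rewrite lee_fin.
  - exact/measurable_EFinP.
  - by rewrite mulr_ge0.
  rewrite -ge0_integralD//; last 4 first.
  - by move=> w _; rewrite lee_fin sqr_ge0.
  - exact/measurable_EFinP.
  - by move=> w _; rewrite -EFinM lee_fin !mulr_ge0.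
  - by apply/measurable_EFinP; exact: measurable_funM.
  rewrite -[X in (_ = _ + X)%E]mule1 -(probability_setT P) -integral_cst//.
  rewrite -ge0_integralD//; last 3 first.
  - by move=> w _; rewrite lee_fin sqr_ge0.
  - exact/measurable_EFinP.
  - by move=> w _; rewrite lee_fin sqr_ge0.
  apply: eq_integral => w _ /=.
  by rewrite -EFinM -!EFinD; congr EFin; ring.
rewrite IX -EFinM => eqI.
(* The cross term is finite, so it may be added to both sides in the extended reals; what remains is
   [c + c ^+ 2 + c ^+ 2 <= c + 2 * c * c]. *)
rewrite -(@leeD2rE _ (2 * c * c)%:E)// eqI.
apply: (le_trans (leeD2r _ IX2)).
by rewrite -!EFinD lee_fin; nra.
Qed.

End sum_of_events.

(** * Counts of i.i.d. samples and the tail of the empirical error *)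

Section sampling.
Context (R : realType) (n m : nat) (A : 'rV[R]_n).
Context (d : measure_display) (T : measurableType d) (P : probability T R).
Variable S : 'I_m -> T -> 'I_n.
Hypothesis hA : is_distribution A.
Hypothesis hS : iid_samples P A S.

Lemma sample_countE i w :
  (sample_count S i w)%:R = \sum_(k < m) \1_(S k @^-1` [set i]) w :> R.
Proof.
rewrite /sample_count -sum1_card natr_sum big_mkcond.
apply: eq_bigr => k _; rewrite indicE inE.
by case: eqP => Ski; [rewrite mem_set | rewrite memNset].
Qed.

(** Mutual independence is specialised to the index set of [k] and [l], with the same target set for
    both; distinctness makes the product have two factors. *)
Lemma sample_pair_law k l i : k != l ->
  P (S k @^-1` [set i] `&` S l @^-1` [set i]) = (A 0 i * A 0 i)%:E.
Proof.
move=> kl; have := sample_indep hS [set k; l]%SET (fun=> [set i]).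
rewrite big_setU1/= ?inE// big_set1 !(sample_law hS) -EFinM => <-.
congr (P _); apply/seteqP; split => w /=.
  by move=> [wk wl] j /=; rewrite !inE => /orP[] /eqP ->.
by move=> H; split; apply: H; rewrite /= !inE eqxx ?orbT.
Qed.

Lemma measurable_sample_count i :
  measurable_fun setT (fun w => (sample_count S i w)%:R : R).
Proof.
under eq_fun do rewrite sample_countE.
by apply: measurable_sum => k; apply: measurable_indic; exact: sample_measurable hS _ _.
Qed.

Lemma sample_count_variance_le i :
  (\int[P]_w (((sample_count S i w)%:R - m%:R * A 0%R i) ^+ 2)%:E <=
   (m%:R * A 0%R i)%:E)%E.
Proof.
under eq_integral do rewrite sample_countE.
apply: variance_sum_events_le.
- exact: hA.1.
- by move=> k; exact: sample_measurable hS _ _.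
- by move=> k; exact: sample_law hS _ _.
- by move=> k l; exact: sample_pair_law.
Qed.

(** The majorant that [powR_dist_natr_le] provides for the sum of the p-th powers of the count
    deviations; being quadratic in the counts, it is controlled by their variances. *)
Let total w : R :=
  \sum_(i < n) (m%:R * A 0 i + ((sample_count S i w)%:R - m%:R * A 0 i) ^+ 2).

Let measurable_term i : measurable_fun setT
  (fun w => m%:R * A 0 i + ((sample_count S i w)%:R - m%:R * A 0 i) ^+ 2).
Proof.
apply: measurable_funD => //; apply: measurable_funX.
by apply: measurable_funB => //; exact: measurable_sample_count.
Qed.

Let mean_ge0 i : 0 <= m%:R * A 0 i.
Proof. by rewrite mulr_ge0// hA.1. Qed.

Let term_ge0 i w :
  0 <= m%:R * A 0 i + ((sample_count S i w)%:R - m%:R * A 0 i) ^+ 2.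
Proof. by rewrite addr_ge0// sqr_ge0. Qed.

Lemma integral_total_le : (\int[P]_w (total w)%:E <= (2 * m%:R)%:E)%E.
Proof.
under eq_integral do rewrite /total -sumEFin.
rewrite ge0_integral_sum//; last 2 first.
- by move=> i; apply/measurable_EFinP.
- by move=> i w _; rewrite lee_fin.
(* As [A] sums to 1, the bound splits over [i]: each index contributes its mean plus a variance no
   larger than that mean. *)
have -> : 2 * m%:R = \sum_(i < n) 2 * (m%:R * A 0 i) :> R.
  by rewrite -!mulr_sumr hA.2 mulr1.
rewrite -sumEFin; apply: lee_sum => i _.
under eq_integral do rewrite EFinD.
rewrite ge0_integralD//; last 3 first.
- by move=> w _; rewrite lee_fin.
- by move=> w _; rewrite lee_fin sqr_ge0.
- apply/measurable_EFinP; apply: measurable_funX.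
  by apply: measurable_funB => //; exact: measurable_sample_count.
rewrite integral_cst// [X in (_ * X)%E](probability_setT P) mule1.
by rewrite [2 * _]mulr_natl mulr2n EFinD leeD2l// sample_count_variance_le.
Qed.

Lemma measurable_pnorm_dist p :
  measurable_fun setT (fun w => pnorm p (empirical R S w - A)).
Proof.
apply: (measurableT_comp (measurable_powR p^-1)).
apply: measurable_sum => i.
apply: (measurableT_comp (measurable_powR p)).
apply: (measurableT_comp (@normr_measurable R setT)
  (g := fun w => (empirical R S w - A) 0 i)).
under eq_fun do rewrite !mxE.
apply: measurable_funB => //; apply: measurable_funM => //.
exact: measurable_sample_count.
Qed.

(** The power [p] cancels the outer root of the norm, and the factor [m%:R], moved inside each
    absolute value, turns frequencies into counts. *)
Lemma pnorm_dist_powR p w : (0 < m)%N -> 0 < p ->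
  pnorm p (empirical R S w - A) `^ p * m%:R `^ p =
  \sum_(i < n) `|(sample_count S i w)%:R - m%:R * A 0 i| `^ p.
Proof.
move=> m0 p0; rewrite /pnorm -powRrM mulVf ?gt_eqF// powRr1; last first.
  by apply: sumr_ge0 => i _; exact: powR_ge0.
rewrite mulr_suml; apply: eq_bigr => i _.
rewrite -powRM// !mxE -{2}[m%:R]ger0_norm// -normrM.
by congr (`|_| `^ _); field; rewrite pnatr_eq0 -lt0n.
Qed.

(** Markov's inequality in multiplied form: the indicator of the tail event, scaled by [eps]^ p *
    m%:R [^ p], lies pointwise below [total]. *)
Lemma pnorm_tail_le p eps : (0 < m)%N -> 1 <= p <= 2 -> 0 <= eps ->
  ((eps `^ p * m%:R `^ p)%:E *
     P [set w | (eps < pnorm p (empirical R S w - A))%R] <=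
   (2 * m%:R)%:E)%E.
Proof.
move=> m0 /andP[p1 p2] eps0; set B := [set w | _].
have p0 : 0 < p by exact: lt_le_trans p1.
have mB : measurable B.
  have := measurable_pnorm_dist p measurableT (measurable_itv `]eps, +oo[).
  rewrite setTI; congr measurable; apply/seteqP; split => w; rewrite /B /=.
    by rewrite in_itv/= andbT.
  by rewrite in_itv/= andbT.
have c0 : 0 <= eps `^ p * m%:R `^ p by rewrite mulr_ge0// powR_ge0.
apply: (le_trans _ integral_total_le).
rewrite -[B]setIT -integral_indic// -ge0_integralZl_EFin//; last first.
  by apply/measurable_EFinP; exact: measurable_indic.
apply: ge0_le_integral => //.
- by move=> w _; rewrite -EFinM lee_fin mulr_ge0// indicE.
- by apply/measurable_EFinP; apply: measurable_funM => //; exact: measurable_indic.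
- by apply/measurable_EFinP; exact: measurable_sum.
move=> w _; rewrite -EFinM lee_fin indicE.
have [/set_mem Bw|_] := boolP (w \in B); last by rewrite mulr0 sumr_ge0.
rewrite mulr1; apply: (@le_trans _ _
    (pnorm p (empirical R S w - A) `^ p * m%:R `^ p)).
  by rewrite ler_wpM2r ?powR_ge0// ge0_ler_powR ?nnegrE ?powR_ge0// ltW.
rewrite pnorm_dist_powR//; apply: ler_sum => i _.
by apply: powR_dist_natr_le => //; rewrite p1.
Qed.

End sampling.

(** * Choice of the sample size, and conclusion *)

Lemma sample_size_bound (R : realType) (p q eps delta M : R) :
  1 < p -> q = p / (p - 1) -> 0 < eps -> 0 < delta ->
  (3 / delta) `^ (1 / (p - 1)) * (1 / eps `^ q) <= M ->
  3 * M <= delta * (eps `^ p * M `^ p).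
Proof.
move=> p1 -> eps0 delta0 hM.
have p10 : 0 < p - 1 by rewrite subr_gt0.
have p1n : p - 1 != 0 by rewrite gt_eqF.
have M0 : 0 < M.
  by rewrite (lt_le_trans _ hM)// mulr_gt0 ?divr_gt0 ?powR_gt0 ?divr_gt0.
have hMp : 3 / delta / eps `^ p <= M `^ (p - 1).
  have := ge0_ler_powR (ltW p10) _ _ hM; rewrite !nnegrE (ltW M0).
  rewrite mulr_ge0 ?powR_ge0 ?divr_ge0 ?powR_ge0// => /(_ isT isT).
  rewrite powRM ?powR_ge0 ?divr_ge0 ?powR_ge0//.
  rewrite -powRrM div1r mulVf// powRr1 ?divr_ge0 ?(ltW delta0)//.
  by rewrite div1r -powRN -powRrM mulNr divfK// powRN.
have e0 : 0 < eps `^ p by exact: powR_gt0.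
rewrite -(mulr_powRB1 (ltW M0)) ?(lt_trans _ p1)//.
rewrite [leRHS](_ : _ = (M `^ (p - 1) * (delta * eps `^ p)) * M); last by ring.
rewrite ler_wpM2r ?(ltW M0)// -ler_pdivrMr ?mulr_gt0//.
by rewrite invfM mulrA.
Qed.

Unset Implicit Arguments.

Theorem theorem7 (R : realType) (p q eps delta : R) (n m : nat)
    (A : 'rV[R]_n)
    (d : measure_display) (T : measurableType d) (P : probability T R)
    (S : 'I_m -> T -> 'I_n)
    (hp1 : 1 < p) (hp2 : p <= 2) (hq : q = p / (p - 1))
    (hn : (2 <= n)%N)
    (heps0 : 0 < eps) (heps1 : eps < 1)
    (hdelta0 : 0 < delta) (hdelta1 : delta < 1)
    (hA : is_distribution A)
    (hm : m%:Z = Num.ceil ((3 / delta) `^ (1 / (p - 1)) * (1 / eps `^ q)))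
    (hS : iid_samples P A S) :
  ((1 - delta)%:E <= P [set w | (pnorm p (empirical R S w - A) <= eps)%R])%E.
Proof.
have hmR : (3 / delta) `^ (1 / (p - 1)) * (1 / eps `^ q) <= m%:R.
  by rewrite (le_trans (ceil_ge _))// -hm.
have mR0 : 0 < m%:R :> R.
  by rewrite (lt_le_trans _ hmR)// mulr_gt0 ?divr_gt0 ?powR_gt0 ?divr_gt0.
have m0 : (0 < m)%N by rewrite -(ltr0n R).
have size_m := sample_size_bound hp1 hq heps0 hdelta0 hmR.
have p12 : 1 <= p <= 2 by rewrite ltW.
have := pnorm_tail_le hA hS m0 p12 (ltW heps0).
set B := [set w | _]; set C := [set w | _].
have mC : measurable C.
  have := measurable_pnorm_dist hS p measurableT (measurable_itv `]-oo, eps]).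
  by rewrite setTI; congr measurable; apply/seteqP; split => w; rewrite /C /= in_itv.
(* Passing to the complement turns the upper bound on the tail into a lower bound on [P C]. *)
have -> : B = ~` C.
  by apply/seteqP; split => w; rewrite /B /C /= ltNge => /negP.
rewrite probability_setC//.
have PC : P C \is a fin_num by exact: fin_num_measure.
rewrite -(fineK PC) -EFinB -EFinM !lee_fin => tail.
have c0 : 0 < eps `^ p * m%:R `^ p by rewrite mulr_gt0 ?powR_gt0.
have : 1 - fine (P C) <= delta; last by lra.
(* After scaling by the positive factor of [c0], the chain is: left side at most [2 * m%:R], at most
   [3 * m%:R], at most the right side by [size_m]. *)
rewrite -(ler_pM2l c0) [leRHS]mulrC (le_trans tail)// (le_trans _ size_m)//.
by rewrite ler_pM2r// ler_nat.
Qed.
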